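(* Let $k\geq 2$ be an integer, let $G$ be a $k$-connected $\Delta$-regular graph with $n$ vertices, and let $H$ be a proper subgraph of $G$. Then $$2\Delta-\mu(H) > \frac{2(k-1)^{2}}{2(n-\Delta)(n-\Delta+2k-4)+(n+1)(k-1)^{2}}.$$
   Context: All graphs are finite, undirected and simple. For a graph $H$, let $A(H)$ be its adjacency matrix and $D(H)$ the diagonal matrix of its vertex degrees. The Laplacian matrix of $H$ is $L(H)=D(H)-A(H)$, and $\mu(H)$ denotes the largest eigenvalue of $L(H)$ (the Laplacian spectral radius). The (vertex) connectivity $\kappa(G)$ of $G$ is the minimum number of vertices whose removal disconnects $G$ or reduces it to a single vertex; $G$ is $k$-connected if $\kappa(G)\geq k$. A proper subgraph of $G$ is a subgraph (with at least one vertex) different from $G$. *)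

(* Defs.v *)
From mathcomp Require Import all_boot all_order all_algebra.

Set Implicit Arguments.
Unset Strict Implicit.
Unset Printing Implicit Defensive.

Import Order.TTheory GRing.Theory Num.Theory.

Local Open Scope ring_scope.

(* Finite simple graphs whose vertices are drawn from an ambient finite type.
   An edge is a two-element set of vertices, so edges are undirected and
   there are neither loops nor multiple edges. *)
Record graph (T : finType) := Graph {
  vertices : {set T};
  edges : {set {set T}};
  edges_wf : [forall e in edges, (e \subset vertices) && (#|e| == 2)%N]
}.

Section Graphs.
Variable T : finType.
Implicit Types (G H : graph T) (x y : T) (S : {set T}).

(* Since well-formedness is a boolean condition, Leibniz equality of graphs is
   equality of their vertex sets and edge sets. *)
Lemma graph_eqP G H :
  G = H <-> vertices G = vertices H /\ edges G = edges H.
Proof.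
split=> [-> //|]; case: G H => [V E w] [V' E' w'] /= [eV eE].
by subst V' E'; rewrite (bool_irrelevance w w').
Qed.

Definition adjacent G : rel T := fun x y => [set x; y] \in edges G.

Lemma adjacent_sym G : symmetric (adjacent G).
Proof. by move=> x y; rewrite /adjacent setUC. Qed.

Lemma adjacentP G x y :
  adjacent G x y -> [&& x \in vertices G, y \in vertices G & x != y].
Proof.
move=> xy; have /forall_inP/(_ _ xy)/andP[sV c2] := edges_wf G.
rewrite !(subsetP sV) ?inE ?eqxx ?orbT //=.
by apply: contraTneq c2 => ->; rewrite setUid cards1.
Qed.

Definition degree G x : nat := #|[set y | adjacent G x y]|.

Definition regular G (d : nat) : Prop :=
  forall x, x \in vertices G -> degree G x = d.

(* The empty graph is not counted as a subgraph. *)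
Definition proper_subgraph H G : Prop :=
  [/\ vertices H != set0, vertices H \subset vertices G,
      edges H \subset edges G & H <> G].

Definition remaining_adjacent G S : rel T :=
  fun x y => [&& x \notin S, y \notin S & adjacent G x y].

Definition disconnects G S : bool :=
  [exists x in vertices G :\: S, exists y in vertices G :\: S,
     ~~ connect (remaining_adjacent G S) x y].

Definition vertex_cut G S : bool :=
  (S \subset vertices G) &&
  (disconnects G S || (#|vertices G :\: S| == 1)%N).

(* The initial value #|V(G)| - 1 is the size of every cut that leaves a single
   vertex; it affects the minimum only for the graph without vertices, which
   gets connectivity 0. *)
Definition connectivity G : nat :=
  \big[minn/#|vertices G|.-1]_(S : {set T} | vertex_cut G S) #|S|.

Lemma connectivity_le G S : vertex_cut G S -> (connectivity G <= #|S|)%N.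
Proof.
move=> cS; rewrite /connectivity.
elim: index_enum (mem_index_enum S) => // U r IH.
rewrite inE big_cons => /orP[/eqP<-|/IH le_r]; first by rewrite cS geq_minl.
by case: ifP => // _; rewrite geq_min le_r orbT.
Qed.

Lemma connectivity_attained G : vertices G != set0 ->
  exists2 S, vertex_cut G S & #|S| = connectivity G.
Proof.
move=> /set0Pn[x xV].
pose P m := exists2 S, vertex_cut G S & #|S| = m.
rewrite -/(P _) /connectivity; apply: big_ind => [|m p Pm Pp|S cS].
- exists (vertices G :\ x); last by rewrite (cardsD1 x (vertices G)) xV.
  have eV : vertices G :\: (vertices G :\ x) = [set x].
    apply/setP=> y; rewrite !inE negb_and negbK.
    by have [->|_] := eqVneq y x; rewrite ?xV //= andNb.
  by rewrite /vertex_cut subD1set eV cards1 orbT.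
- by rewrite /minn; case: ifP.
- by exists S.
Qed.

Definition k_connected (k : nat) G : Prop := (k <= connectivity G)%N.

Definition adjacency_matrix (R : pzRingType) H : 'M[R]_#|vertices H| :=
  \matrix_(i, j) (adjacent H (enum_val i) (enum_val j))%:R.

Definition degree_matrix (R : pzRingType) H : 'M[R]_#|vertices H| :=
  diag_mx (\row_i (degree H (enum_val i))%:R).

Definition laplacian (R : pzRingType) H : 'M[R]_#|vertices H| :=
  degree_matrix R H - adjacency_matrix R H.

Lemma laplacian_sym (R : pzRingType) H : (laplacian R H)^T = laplacian R H.
Proof.
apply/matrixP=> i j; rewrite !mxE adjacent_sym eq_sym.
by case: eqVneq => [->|].
Qed.

End Graphs.

From mathcomp Require Import all_classical all_reals.
From mathcomp Require complex polyrcf.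

Definition largest_eigenvalue (R : realType) n (A : 'M[R]_n) : R :=
  sup [set a | eigenvalue A a]%classic.

Definition laplacian_radius (R : realType) (T : finType) (H : graph T) : R :=
  largest_eigenvalue (laplacian R H).

Section SymmetricEigenvalues.
Import complex.
Local Open Scope complex_scope.

Lemma symmetric_has_eigenvalue (R : rcfType) n (A : 'M[R]_n) :
  (0 < n)%N -> A^T = A -> exists a, eigenvalue A a.
Proof.
move=> n0 symA; pose C : numClosedFieldType := R[i].
pose f : {rmorphism R -> C} := real_complex R.
have [z Az] := eigenvalue_closed (map_mx f A) n0.
suff /complex_realP[a za] : z \is Num.real.
  by exists a; rewrite -(eigenvalue_map f) (_ : f a = z).
have /eigenvalueP[v vA v0] := Az.
pose w := map_mx (Num.conj : C -> C) v.
have wA : w *m map_mx f A = z^* *: w.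
  rewrite /w -map_mxZ -vA map_mxM -map_mx_comp; congr (_ *m _).
  by apply/matrixP=> i j; rewrite !mxE /=; apply/esym/conjc_real.
have Aw : map_mx f A *m w^T = z^* *: w^T.
  by rewrite -[in LHS]symA -map_trmx -trmx_mul wA linearZ.
have eqz : z *: (v *m w^T) = z^* *: (v *m w^T).
  by rewrite scalemxAl -vA -mulmxA Aw scalemxAr.
have vw0 : (v *m w^T) 0 0 != 0.
  rewrite mxE psumr_eq0 => [|i _]; last by rewrite !mxE mul_conjC_ge0.
  apply: contra v0 => /allP h; apply/eqP/rowP=> i.
  have := h i (mem_index_enum i).
  by rewrite /= !mxE mul_conjC_eq0 => /eqP.
have /matrixP/(_ 0 0) := eqz; rewrite [LHS]mxE [RHS]mxE.
by move=> /(mulIf vw0)/esym/eqP; rewrite -CrealE.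
Qed.

End SymmetricEigenvalues.

(* The supremum is a maximum for the matrices it is applied to. *)
Lemma largest_eigenvalueP (R : realType) n (A : 'M[R]_n) :
  (0 < n)%N -> A^T = A ->
  eigenvalue A (largest_eigenvalue A) /\
  forall a, eigenvalue A a -> a <= largest_eigenvalue A.
Proof.
move=> n0 symA; have [a0 Aa0] := symmetric_has_eigenvalue n0 symA.
pose s := polyrcf.rootsR (char_poly A).
have sE a : (a \in s) = eigenvalue A a.
  rewrite eigenvalue_root_char /s -polyrcf.roots_on_rootsR //.
  by rewrite monic_neq0 ?char_poly_monic.
pose m := \big[Num.max/a0]_(a <- s) a.
have Am : eigenvalue A m.
  rewrite /m big_seq; apply: (big_ind (eigenvalue A)) => // [x y ? ?|x].
    by rewrite maxEle; case: ifP.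
  by rewrite sE.
have leAm a : eigenvalue A a -> a <= m.
  by rewrite -sE => sa; exact: le_bigmax_seq.
suff -> : largest_eigenvalue A = m by [].
apply/le_anti/andP; split; first exact: (@ge_sup _ _ m (ex_intro _ m Am) leAm).
by apply: (@ub_le_sup _ [set a | eigenvalue A a]%classic) => //; exists m.
Qed.

Lemma laplacian_radiusP (R : realType) (T : finType) (H : graph T) :
  vertices H != finset.set0 ->
  eigenvalue (laplacian R H) (laplacian_radius R H) /\
  forall a, eigenvalue (laplacian R H) a -> a <= laplacian_radius R H.
Proof.
by rewrite -card_gt0 => H0; exact: largest_eigenvalueP (laplacian_sym R H).
Qed.

(* Main.v *)
Require Import Defs.
From mathcomp Require Import all_boot all_order all_algebra.
From mathcomp Require Import reals.
From mathcomp Require Import zify ring lra.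

Import Order.TTheory GRing.Theory Num.Theory.
Local Open Scope ring_scope.

Set Implicit Arguments.
Unset Strict Implicit.
Unset Printing Implicit Defensive.

(** Let x be an eigenvector of L(H) for mu(H), extended by 0 to all vertices,
    and let y = |x| and E(y) be the sum of (y_p - y_q)^2 over the edges pq of
    G.  An edge uv of G is missing from H.  Since (x_p - x_q)^2 is at most
    (y_p + y_q)^2, and since in a Delta-regular graph the sum of
    (y_p + y_q)^2 over the edges is 2 Delta |y|^2 - E(y), leaving out uv gives
        (2 Delta - mu(H)) |y|^2 >= (y_u + y_v)^2 + E(y) =: F
    ([regular_gap]).  It remains to bound |y|^2 by a multiple of F
    ([sum_sqr_bound]).  Say y_u <= y_v, so that y_u is at most half of
    y_u + y_v.  The values of y on the neighbours of u differ from y_u by an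
    amount whose squares add up to at most E(y), so together they cost about
    Delta/2 times F.  For each of the n - Delta - 1 other vertices i,
    k-connectivity gives
        k^2 (y_i - y_u)^2 <= (n - Delta + 2k - 2) E(y)
    ([potential_drop]), which is slightly better than what is needed: the
    strict inequality comes from the slack in the final comparison of
    constants.

    The estimate of [potential_drop] is what k internally disjoint i-u paths
    of small total length would give, by the Cauchy-Schwarz inequality.  The
    paths are not needed: it suffices to find a set of at most
    n - Delta + 2k - 2 edges such that every level z between y_u and y_i lies
    between the end values of at least k of them.  Their drops then add up to
    at least k (y_i - y_u) ([cover_multiplicity_length]), and Cauchy-Schwarz
    applies as before.  The edges are those from i to its k lowest neighbours,
    and for most other vertices q the steepest edge descending from q.  If
    fewer than k of them crossed a level, one end of each could be chosen so
    as to form a vertex cut with fewer than k vertices. *)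

(** * Finite sums, intervals and extremal subsets *)

Lemma sqr_sum_le_card (R : realFieldType) (J : finType) (A : {set J})
    (f : J -> R) :
  (\sum_(j in A) f j) ^+ 2 <= #|A|%:R * \sum_(j in A) f j ^+ 2.
Proof.
set X := \sum_(j in A) f j; set N : R := #|A|%:R.
have [A0|A0] := posnP #|A|.
  by rewrite /X /N A0 (cards0_eq A0) !big_set0 mul0r expr0n.
have N0 : 0 < N by rewrite ltr0n.
have : 0 <= \sum_(j in A) (N * f j - X) ^+ 2.
  by apply: sumr_ge0 => j _; apply: sqr_ge0.
have -> : \sum_(j in A) (N * f j - X) ^+ 2 =
    N * (N * (\sum_(j in A) f j ^+ 2) - X ^+ 2).
  rewrite (eq_bigr (fun j => N ^+ 2 * f j ^+ 2 - 2 * N * X * f j + X ^+ 2)).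
    by rewrite big_split sumrB -!mulr_sumr -/X sumr_const -mulr_natr -/N /=; ring.
  by move=> j _; ring.
by rewrite pmulr_rge0 // subr_ge0.
Qed.

(** A discrete coarea inequality: the lengths of the intervals ]lo j, hi j]
    integrate the number of intervals over a point.  Cutting [a, b] at the
    left ends that lie inside it makes this number constant up to intervals
    that only help, so no integration is needed. *)
Lemma cover_multiplicity_length (R : realFieldType) (J : finType)
    (A : {set J}) (lo hi : J -> R) (t : nat) (a b : R) :
  a <= b -> (forall j, j \in A -> lo j <= hi j) ->
  (forall z, a < z <= b -> (t <= #|[set j in A | (lo j < z <= hi j)%R]|)%N) ->
  t%:R * (b - a) <= \sum_(j in A) (hi j - lo j).
Proof.
move=> leab lohi cov.
(* [clip b j - clip a j] is the length of the part of the interval j inside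
   ]a, b]; unlike [hi j - lo j] it is additive when [a, b] is cut. *)
pose clip (x : R) j := Num.max (lo j) (Num.min x (hi j)).
apply: (@le_trans _ _ (\sum_(j in A) (clip b j - clip a j))); last first.
  apply: ler_sum => j /lohi lh; apply: lerB; rewrite /clip.
    by rewrite ge_max lh ge_min lexx orbT.
  by rewrite le_max lexx.
have [m] := ubnP #|[set j in A | a < lo j < b]|.
elim: m a b leab cov => // m IH a b leab cov; rewrite ltnS => lem.
have [/set0Pn[j]|] := boolP ([set j in A | a < lo j < b] != set0).
  rewrite inE => /and3P[jA aj jb].
  set c := lo j.
  have -> : t%:R * (b - a) = t%:R * (c - a) + t%:R * (b - c) by ring.
  have -> : \sum_(i in A) (clip b i - clip a i) =
     \sum_(i in A) (clip c i - clip a i) + \sum_(i in A) (clip b i - clip c i).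
    by rewrite -big_split; apply: eq_bigr => i _ /=; ring.
  apply: lerD; apply: IH; rewrite ?ltW //.
  - by move=> z /andP[az zc]; apply: cov; rewrite az (le_trans zc (ltW jb)).
  - apply: leq_trans lem; apply: proper_card; apply/properP; split.
      apply/subsetP=> i; rewrite !inE => /and3P[-> -> /= ic].
      exact: lt_trans ic jb.
    by exists j; rewrite !inE jA ?aj ?jb //= -/c ltxx ?andbF.
  - by move=> z /andP[cz zb]; apply: cov; rewrite zb (lt_trans aj cz).
  - apply: leq_trans lem; apply: proper_card; apply/properP; split.
      apply/subsetP=> i; rewrite !inE => /and3P[-> ci -> /=].
      by rewrite andbT; exact: lt_trans aj ci.
    by exists j; rewrite !inE jA ?aj ?jb //= -/c ltxx ?andbF.
rewrite negbK => /eqP none.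
have [<-|neab] := eqVneq a b.
  by rewrite subrr mulr0 sumr_ge0 // => j _; rewrite subrr.
have ltab : a < b by rewrite lt_neqAle neab.
(* No interval starts strictly inside ]a, b[, so one that contains b contains
   ]a, b]. *)
set C := [set j in A | lo j < b <= hi j].
apply: (@le_trans _ _ (\sum_(j in C) (b - a))).
  rewrite sumr_const -[leRHS]mulr_natl ler_wpM2r ?subr_ge0 // ler_nat.
  by apply: cov; rewrite ltab lexx.
rewrite [leRHS](big_setID C) /=.
have -> : A :&: C = C by apply/setIidPr/subsetP=> j; rewrite inE => /andP[].
rewrite -[leLHS]addr0; apply: lerD.
  apply: ler_sum => j; rewrite inE => /and3P[jA jb bj].
  have : j \notin [set j in A | a < lo j < b] by rewrite none inE.
  rewrite inE jA jb andbT /= -leNgt => lea.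
  rewrite /clip (min_l bj) (max_r (ltW jb)) (min_l (le_trans leab bj)).
  by rewrite (max_r lea).
apply: sumr_ge0 => j _; rewrite subr_ge0.
by rewrite ge_max !le_max lexx /= le_min !ge_min leab lexx !orbT.
Qed.

Lemma exists_lowest (R : realDomainType) (T : finType) (y : T -> R)
    (A : {set T}) (t : nat) : (t <= #|A|)%N ->
  exists P : {set T}, [/\ P \subset A, #|P| = t &
    forall p q, p \in P -> q \in A :\: P -> y p <= y q].
Proof.
elim: t => [_|t IH lt].
  by exists set0; rewrite sub0set cards0; split=> // p q; rewrite inE.
have [P [sPA cP lowP]] := IH (ltnW lt).
have : A :\: P != set0 by rewrite -card_gt0 cardsDS // cP subn_gt0.
move=> /set0Pn[r0 r0in].
case: (@arg_minP _ _ _ r0 [in A :\: P] y r0in) => r rin rmin.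
have [rA rP] := setDP rin.
exists (r |: P); split.
- by rewrite subUset sub1set rA.
- by rewrite cardsU1 rP cP.
- move=> p q pP /setDP[qA]; rewrite !inE negb_or => /andP[qr qP].
  have qin : q \in A :\: P by rewrite inE qP.
  by move: pP; rewrite !inE => /orP[/eqP->|/lowP]; [exact: rmin|exact].
Qed.

(** * Vertex cuts and edge energy *)

Section Graphs.
Variables (T : finType) (G : graph T).
Implicit Types (u v p q : T).

Definition neighbours u := [set p | adjacent G u p].

Lemma neighbours_sub u : neighbours u \subset vertices G.
Proof. by apply/subsetP=> p; rewrite inE => /adjacentP/and3P[]. Qed.

(** If every edge leaving U has an end in X, then removing X leaves no edge
    between U and its complement, so X separates u from v. *)
Lemma separator_card (X U : {set T}) u v :
  X \subset vertices G -> u \in vertices G -> v \in vertices G ->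
  u \notin X -> v \notin X -> u \in U -> v \notin U ->
  (forall p q, p \in U -> q \notin U -> adjacent G p q ->
     (p \in X) || (q \in X)) ->
  (connectivity G <= #|X|)%N.
Proof.
move=> sX uV vV uX vX uU vU cover; apply: connectivity_le.
rewrite /vertex_cut sX /=; apply/orP; left.
apply/exists_inP; exists u; first by rewrite inE uX.
apply/exists_inP; exists v; first by rewrite inE vX.
apply: contra vU => /(closed_connect _)<- //.
apply: intro_closed => [|p q /and3P[pX qX pq] pU].
  apply: sym_connect_sym => p q.
  by rewrite /remaining_adjacent adjacent_sym andbCA.
by apply: contraTT isT => /(cover _ _ pU)/(_ pq); rewrite (negPf pX) (negPf qX).
Qed.

(** The neighbours of u cut it off, or leave it alone. *)
Lemma connectivity_le_degree u :
  u \in vertices G -> (connectivity G <= degree G u)%N.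
Proof.
move=> uV; have uN : u \notin neighbours u.
  by rewrite inE; apply/negP => /adjacentP; rewrite eqxx !andbF.
have [eqV|/set0Pn[w]] := eqVneq (vertices G :\: (u |: neighbours u)) set0.
  apply: connectivity_le; rewrite /vertex_cut neighbours_sub; apply/orP; right.
  suff -> : vertices G :\: neighbours u = [set u] by rewrite cards1.
  apply/setP=> p; rewrite !inE; have := in_set0 p; rewrite -eqV !inE.
  have [->|_] := eqVneq p u; first by move: uN; rewrite inE uV => ->.
  by [].
rewrite !inE negb_or => /andP[/andP[wu wN] wV].
apply: (@separator_card _ [set u] u w); rewrite ?inE ?eqxx ?neighbours_sub //.
  by rewrite inE in uN.
by move=> p q; rewrite !inE => /eqP-> _ ->; rewrite orbT.
Qed.

Lemma degree_lt_order u : u \in vertices G -> (degree G u < #|vertices G|)%N.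
Proof.
move=> uV; apply: proper_card; apply/properP; split.
  exact: neighbours_sub.
by exists u; rewrite // inE; apply/negP => /adjacentP; rewrite eqxx !andbF.
Qed.

Section Energy.
Variable R : realFieldType.
Implicit Type y : T -> R.

(** The Laplacian quadratic form; the factor 1/2 compensates for ordered pairs,
    which count every edge twice. *)
Definition energy y : R :=
  2^-1 * \sum_(e : T * T | adjacent G e.1 e.2) (y e.1 - y e.2) ^+ 2.

Lemma oriented_le_energy y (A : {set T * T}) :
  (forall e, e \in A -> adjacent G e.1 e.2 && ((e.2, e.1) \notin A)) ->
  \sum_(e in A) (y e.1 - y e.2) ^+ 2 <= energy y.
Proof.
move=> orA; pose sw (e : T * T) := (e.2, e.1).
have swK : involutive sw by case.
have FC e : (y (sw e).1 - y (sw e).2) ^+ 2 = (y e.1 - y e.2) ^+ 2.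
  by rewrite -opprB sqrrN.
rewrite /energy ler_pdivlMl // mulr_natl mulr2n.
rewrite [leRHS](bigID [in A]) /=; apply: lerD.
  rewrite le_eqVlt; apply/orP; left; apply/eqP/eq_bigl => e.
  by case eA: (e \in A); rewrite ?andbF // andbT; case/andP: (orA e eA) => ->.
rewrite (reindex_inj (inv_inj swK)) /= [leRHS](bigID (fun e => sw e \in A)) /=.
rewrite -[leLHS]addr0; apply: lerD; last first.
  by apply: sumr_ge0 => e _; exact: sqr_ge0.
rewrite le_eqVlt; apply/orP; left; apply/eqP.
rewrite (eq_bigr _ (fun e _ => FC e)); apply: eq_bigl => e.
case eA: (sw e \in A); rewrite ?andbF // andbT; have /= := orA _ eA.
by rewrite adjacent_sym -surjective_pairing => /andP[-> ->].
Qed.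

Lemma energy_ge0 y : 0 <= energy y.
Proof.
by rewrite /energy mulr_ge0 ?invr_ge0 // sumr_ge0 // => e _; exact: sqr_ge0.
Qed.

Lemma sum_neighbours_le_energy y u :
  \sum_(p in neighbours u) (y p - y u) ^+ 2 <= energy y.
Proof.
pose A := [set (p, u) | p in neighbours u].
have <- : \sum_(e in A) (y e.1 - y e.2) ^+ 2 =
          \sum_(p in neighbours u) (y p - y u) ^+ 2.
  by rewrite big_imset //= => p q _ _ [].
apply: oriented_le_energy => e /imsetP[p]; rewrite inE => up -> /=.
rewrite adjacent_sym up /=; apply: contraTN up => /imsetP[q _ [_ ->]].
by apply/negP => /adjacentP; rewrite eqxx !andbF.
Qed.
End Energy.
End Graphs.

(** * Potential drop in a k-connected graph *)

Lemma exists_lowest_neighbour (R : realDomainType) (T : finType) (G : graph T)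
    (y : T -> R) :
  exists low : T -> T, forall p q,
    adjacent G p q -> adjacent G p (low p) && (y (low p) <= y q).
Proof.
suff /fin_all_exists[low lowP] : forall p, exists l, forall q,
    adjacent G p q -> adjacent G p l && (y l <= y q) by exists low.
move=> p; have [q0 pq0|none] := pickP (adjacent G p); last first.
  by exists p => q; rewrite none.
exists [arg min_(q < q0 | adjacent G p q) y q]%O.
by case: arg_minP => // l -> le_l q /le_l ->.
Qed.

(** In electrical terms, the effective resistance between the nonadjacent
    vertices u and i is at most (n - deg u + 2k - 2) / k^2.  One edge is
    counted for each vertex, except that all neighbours of u but k are
    discarded, and that i has k edges. *)
Lemma potential_drop (R : realFieldType) (T : finType) (G : graph T)
    (k : nat) (u i : T) (y : T -> R) :
  (k <= connectivity G)%N -> u \in vertices G -> i \in vertices G ->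
  i != u -> ~~ adjacent G u i -> y u <= y i ->
  k%:R ^+ 2 * (y i - y u) ^+ 2 <=
  (#|vertices G|%:R - (degree G u)%:R + 2 * k%:R - 2) * energy G y.
Proof.
move=> kG uV iV iu nui leui.
have kdeg p : p \in vertices G -> (k <= #|neighbours G p|)%N.
  by move=> /connectivity_le_degree; exact: leq_trans.
(* [Top] consists of the k highest neighbours of u: [- y] is lowest there. *)
have [Top [sTop cTop highTop]] :
    exists P : {set T}, [/\ P \subset neighbours G u, #|P| = k &
      forall p q, p \in P -> q \in neighbours G u :\: P -> - y p <= - y q].
  by apply: exists_lowest; exact: kdeg.
have [P [sP cP lowP]] := exists_lowest y (kdeg i iV).
have [low lowE] := exists_lowest_neighbour G y.
have uN : u \notin neighbours G u.
  by rewrite inE; apply/negP => /adjacentP; rewrite eqxx !andbF.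
have iN : i \notin neighbours G u by rewrite inE.
pose Q := vertices G :\: ([set i; u] :|: (neighbours G u :\: Top)).
pose Om := [set e in [set (i, p) | p in P] :|: [set (q, low q) | q in Q]
              | adjacent G e.1 e.2 & y e.2 < y e.1].
have cQ : (#|Q| + 2 + degree G u = #|vertices G| + k)%N.
  have dis : [set i; u] :&: (neighbours G u :\: Top) = set0.
    apply/setP=> p; rewrite in_setI in_set2 in_setD in_set0.
    apply/negP => /andP[/orP[]/eqP-> /andP[_]]; first by rewrite (negPf iN).
    by rewrite (negPf uN).
  have sub : [set i; u] :|: (neighbours G u :\: Top) \subset vertices G.
    rewrite !subUset !sub1set iV uV /= (subset_trans (subsetDl _ _)) //.
    exact: neighbours_sub.
  have := subset_leq_card sub; have := kdeg u uV.
  rewrite /Q cardsDS // cardsU dis cards0 cardsDS // cTop cards2 iu.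
  by rewrite /degree -/(neighbours G u); lia.
have cOm : (#|Om| <= k + #|Q|)%N.
  rewrite -cP.
  apply: (@leq_trans #|[set (i, p) | p in P] :|: [set (q, low q) | q in Q]|).
    by apply/subset_leq_card/subsetP=> e; rewrite inE => /andP[].
  rewrite (leq_trans (leq_card_setU _ _)) //.
  by apply: leq_add; exact: leq_imset_card.
have orOm e : e \in Om -> adjacent G e.1 e.2 && ((e.2, e.1) \notin Om).
  rewrite !inE /= => /and3P[_ -> lt]; rewrite !negb_and -leNgt.
  by rewrite (ltW lt) !orbT.
have crossing z : y u < z <= y i ->
    (k <= #|[set e in Om | (y e.2 < z <= y e.1)%R]|)%N.
  move=> /andP[uz zi].
  (* A vertex of X below z stands for the edge joining it to i, one above z for
     its steepest descending edge; these edges are distinct since i is not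
     in Q. *)
  have inject (X : {set T}) : (forall q, q \in X ->
      ((q \in P) && (y q < z)) ||
      [&& q \in Q, adjacent G q (low q) & y (low q) < z <= y q]) ->
      (#|X| <= #|[set e in Om | (y e.2 < z <= y e.1)%R]|)%N.
    move=> XP; pose f q := if y q < z then (i, q) else (q, low q).
    have fX : {in X &, injective f}.
      move=> p q pX qX; rewrite /f.
      have {pX} := XP p pX; have {qX} := XP q qX.
      case: (ltP (y p) z) => pz; case: (ltP (y q) z) => qz; rewrite ?andbF ?orbF /=.
      - by move=> _ _ [].
      - by rewrite !inE => /and3P[/andP[+ _] _ _] _ [iq]; rewrite iq eqxx.
      - by move=> _; rewrite !inE => /and3P[/andP[+ _] _ _] [pi]; rewrite pi eqxx.
      - by move=> _ _ [].
    rewrite -(card_in_imset fX); apply/subset_leq_card/subsetP => e.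
    case/imsetP=> q /XP Xq ->{e}; rewrite /f; case: ltP Xq => qz.
      rewrite !andbF andbT orbF => qP; rewrite !inE /= qz zi (imset_f _ qP).
      have := subsetP sP q qP; rewrite inE => -> /=.
      by rewrite (lt_le_trans qz zi).
    rewrite andbF /= => /and4P[qQ qlow lz _]; rewrite !inE /= lz qz qlow.
    by rewrite (imset_f (fun q => (q, low q)) qQ) orbT (lt_le_trans lz qz).
  (* If no vertex of [Top] is below z, the steepest edges descending from [Top]
     cross z, because they descend at least to the level of u. *)
  have [allTop|] := boolP [forall q in Top, z <= y q].
    rewrite -cTop; apply: inject => q qT; have zq := forall_inP allTop q qT.
    have qN := subsetP sTop q qT.
    have /lowE/andP[qlow lelow] : adjacent G q u.
      by rewrite adjacent_sym; rewrite inE in qN.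
    have qV := subsetP (neighbours_sub G u) q qN.
    rewrite zq qlow (le_lt_trans lelow uz) !inE qT qV /= !andbT orbF negb_or.
    by rewrite (contraTneq _ qN) ?(contraTneq _ qN) ?orbT // => ->.
  rewrite negb_forall => /existsP[w]; rewrite negb_imply -ltNge => /andP[wT wz].
  (* Otherwise the discarded neighbours of u are below z.  If all of [P] is
     below z too, the edges from i to [P] cross z. *)
  have [allP|] := boolP [forall p in P, y p < z].
    by rewrite -cP; apply: inject => q qP; rewrite qP (forall_inP allP q qP).
  rewrite negb_forall => /existsP[p0]; rewrite negb_imply -leNgt => /andP[p0P zp0].
  (* Otherwise the discarded neighbours of i are not below z, and X meets every
     edge crossing z without containing u or i: it is a vertex cut. *)
  pose X := [set q | ((q \in P) && (y q < z)) ||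
      [&& q \in Q, adjacent G q (low q) & y (low q) < z <= y q]].
  apply: leq_trans (inject X _); last by move=> q; rewrite inE.
  apply: (leq_trans kG).
  have iNi : i \notin P.
    apply: contra (subsetP sP i) _ => //.
    by rewrite inE; apply/negP => /adjacentP; rewrite eqxx !andbF.
  have uNP : u \notin P.
    apply: contra nui => /(subsetP sP); by rewrite inE adjacent_sym.
  apply: (@separator_card _ _ X [set q | z <= y q] i u) => //.
  - apply/subsetP=> q; rewrite inE => /orP[/andP[/(subsetP sP)]|/andP[/setDP[]]//].
    by move=> /(subsetP (neighbours_sub G i)).
  - by rewrite !inE eqxx (negPf iNi).
  - by rewrite !inE eqxx orbT (negPf uNP).
  - by rewrite inE.
  - by rewrite inE -ltNge.
  move=> p q; rewrite !inE -ltNge => zp qz pq.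
  have [ip|ip] := eqVneq p i.
    apply/orP; right; apply/orP; left; rewrite qz andbT.
    apply: contraTT qz => qP; rewrite -leNgt (le_trans zp0) // lowP //.
    by rewrite !inE qP -ip.
  have up : p != u by apply: contraTneq zp => ->; rewrite -ltNge.
  have /andP[plow lelow] := lowE p q pq.
  have /and3P[pV _ _] := adjacentP pq.
  apply/orP; left; apply/orP; right.
  rewrite zp plow (le_lt_trans lelow qz) pV (negPf up) !andbT /= negb_and negbK.
  apply: contraTT zp; rewrite negb_or => /andP[pT]; rewrite negbK => pN.
  rewrite -ltNge (le_lt_trans _ wz) // -lerN2 highTop // !inE pT /=.
  by rewrite pN.
have lohi e : e \in Om -> y e.2 <= y e.1 by rewrite inE => /and3P[_ _ /ltW].
have len := cover_multiplicity_length leui lohi crossing.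
have -> : #|vertices G|%:R - (degree G u)%:R + 2 * k%:R - 2 = (k + #|Q|)%:R :> R.
  have := congr1 (fun m : nat => m%:R : R) cQ; rewrite !natrD; lra.
rewrite -exprMn.
apply: (@le_trans _ _ ((\sum_(e in Om) (y e.1 - y e.2)) ^+ 2)).
  rewrite ler_sqr // nnegrE ?mulr_ge0 ?subr_ge0 // (le_trans _ len) //.
  by rewrite mulr_ge0 ?subr_ge0.
apply: le_trans (sqr_sum_le_card _ _) _.
apply: ler_pM; rewrite ?ler0n ?ler_nat //.
  by apply: sumr_ge0 => e _; exact: sqr_ge0.
exact: oriented_le_energy.
Qed.

(** * The Laplacian spectrum *)

Lemma sum_incident (R : nmodType) (T : finType) (G : graph T) (f : T -> R) :
  \sum_(e : T * T | adjacent G e.1 e.2) f e.1 = \sum_p f p *+ degree G p.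
Proof.
rewrite -(pair_big_dep xpredT (adjacent G) (fun p _ => f p)) /=.
by apply: eq_bigr => p _; rewrite sumr_const /degree cardsE.
Qed.

Lemma sum_adjacent_swap (R : nmodType) (T : finType) (G : graph T)
    (F : T -> T -> R) :
  \sum_(e : T * T | adjacent G e.1 e.2) F e.2 e.1 =
  \sum_(e : T * T | adjacent G e.1 e.2) F e.1 e.2.
Proof.
have swK : involutive (fun e : T * T => (e.2, e.1)) by case.
rewrite (reindex_inj (inv_inj swK)) /=.
by apply: eq_bigl => e; rewrite adjacent_sym.
Qed.

(** The eigenvector read as a function on the ambient type, so that H and G can
    be compared on the same index set. *)
Lemma laplacian_eigenfunction (R : realFieldType) (T : finType) (H : graph T)
    (mu : R) : eigenvalue (laplacian R H) mu ->
  exists x : T -> R, [/\ forall p, p \notin vertices H -> x p = 0,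
    0 < \sum_p x p ^+ 2 & energy H x = mu * \sum_p x p ^+ 2].
Proof.
case/eigenvalueP=> v vL v0.
pose x q := \sum_(j | enum_val j == q) v 0 j.
have xE j : x (enum_val j) = v 0 j.
  by rewrite /x (eq_bigl _ _ (fun l => inj_eq enum_val_inj l j)) big_pred1_eq.
have x0 p : p \notin vertices H -> x p = 0.
  move=> pH; rewrite /x big_pred0 // => j.
  by apply: contraNF pH => /eqP <-; exact: enum_valP.
exists x; split=> //.
  rewrite lt_neqAle eq_sym sumr_ge0 ?andbT => [|p _]; last exact: sqr_ge0.
  apply: contra v0; rewrite psumr_eq0 => [/allP x20|p _]; last exact: sqr_ge0.
  apply/eqP/rowP=> j; rewrite mxE -xE; apply/eqP.
  by have := x20 (enum_val j) (mem_index_enum _); rewrite /= sqrf_eq0.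
have eqp p : (degree H p)%:R * x p - \sum_(q | adjacent H p q) x q = mu * x p.
  have [pH|pH] := boolP (p \in vertices H); last first.
    rewrite x0 // !mulr0 sub0r big_pred0 ?oppr0 // => q.
    by apply: contraNF pH => /adjacentP/and3P[].
  have := congr1 (fun w : 'rV_ _ => w 0 (enum_rank_in pH p)) vL.
  rewrite !mxE -xE enum_rankK_in // => <-.
  rewrite (eq_bigr (fun j => x (enum_val j) * ((degree H (enum_val j))%:R *+
    (enum_val j == p) - (adjacent H (enum_val j) p)%:R))); last first.
    move=> j _; rewrite !mxE -xE enum_rankK_in //; congr (_ * (_ *+ _ - _)).
    by congr nat_of_bool; apply/eqP/eqP => [jE|jp];
       [rewrite jE enum_rankK_in | rewrite -(enum_valK_in pH j) jp].
  rewrite -(big_enum_val (fun q => x q * ((degree H q)%:R *+ (q == p)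
     - (adjacent H q p)%:R))) /=.
  symmetry; under eq_bigr => q _ do rewrite mulrBr.
  rewrite sumrB (bigD1 p) //= eqxx mulr1n big1 ?addr0 => [|q /andP[_ /negPf->]];
    last by rewrite mulr0n mulr0.
  rewrite mulrC; congr (_ - _).
  rewrite big_mkcond [RHS]big_mkcond; apply: eq_bigr => q _.
  rewrite [adjacent H q p]adjacent_sym.
  case pq: (adjacent H p q); last by rewrite mulr0 if_same.
  by have /and3P[_ -> _] := adjacentP pq; rewrite mulr1.
rewrite /energy (eq_bigr (fun e => (x e.1 ^+ 2 + x e.2 ^+ 2) - (x e.1 * x e.2) *+ 2)).
  rewrite sumrB big_split /= (sum_adjacent_swap H (fun p _ => x p ^+ 2)).
  rewrite -mulr2n sumrMnl -mulrnBl -[X in _ * X]mulr_natl mulKf ?pnatr_eq0 //.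
  rewrite (sum_incident H (fun p => x p ^+ 2)).
  rewrite -(pair_big_dep xpredT (adjacent H) (fun p q => x p * x q)) /=.
  rewrite -sumrB mulr_sumr; apply: eq_bigr => p _.
  by rewrite -mulr_sumr expr2 mulrA -eqp -mulr_natl; ring.
by move=> e _; ring.
Qed.

(** * Comparing the quadratic forms of H and G *)

(** If only vertices are missing from H, then so are the edges at a missing
    vertex, and there are some because the degrees are positive. *)
Lemma exists_missing_edge (T : finType) (G H : graph T) (Delta : nat) :
  (0 < Delta)%N -> regular G Delta -> proper_subgraph H G ->
  exists u v, adjacent G u v && ~~ adjacent H u v.
Proof.
move=> D0 reg [H0 sV sE HG].
have [sE'|/subsetPn[e eG eH]] := boolP (edges G \subset edges H); last first.
  have /forall_inP/(_ _ eG)/andP[_ /cards2P[u [v [_ euv]]]] := edges_wf G.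
  by exists u, v; rewrite /adjacent -euv eG.
have eE : edges H = edges G by apply/eqP; rewrite eqEsubset sE.
have /subsetPn[w wG wH] : ~~ (vertices G \subset vertices H).
  apply/negP => sV'; apply/HG/graph_eqP; split=> //.
  by apply/eqP; rewrite eqEsubset sV.
have : (0 < degree G w)%N by rewrite reg.
case/card_gt0P=> q; rewrite inE /adjacent -eE => /adjacentP.
by rewrite (negPf wH).
Qed.

(** Passing to absolute values turns the Laplacian form of H into at most the
    signless form of G without the edge uv, and regularity turns the signless
    form of G into its complement in 2 Delta |x|^2. *)
Lemma regular_gap (R : realFieldType) (T : finType) (G H : graph T)
    (Delta : nat) (x : T -> R) (u v : T) :
  regular G Delta -> edges H \subset edges G ->
  (forall p, p \notin vertices G -> x p = 0) ->
  adjacent G u v -> ~~ adjacent H u v ->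
  energy H x + (`|x u| + `|x v|) ^+ 2 + energy G (fun p => `|x p|) <=
  2 * Delta%:R * \sum_p x p ^+ 2.
Proof.
move=> reg sE x0 Guv Huv; set y := fun p => `|x p|.
have HG p q : adjacent H p q -> adjacent G p q by exact: (subsetP sE).
have uv : u != v by case/adjacentP/and3P: Guv.
pose plus := \sum_(e : T * T | adjacent G e.1 e.2) (y e.1 + y e.2) ^+ 2.
have leH : \sum_(e : T * T | adjacent H e.1 e.2) (x e.1 - x e.2) ^+ 2
    + 2 * (y u + y v) ^+ 2 <= plus.
  rewrite /plus [leRHS](bigD1 (u, v)) //= [X in _ <= _ + X](bigD1 (v, u)) /=; last first.
    by rewrite adjacent_sym Guv; apply: contraNneq uv => -[->].
  rewrite [X in _ <= _ + (X + _)](_ : _ = (y u + y v) ^+ 2); last by ring.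
  rewrite addrA -mulr2n -[X in _ <= X + _]mulr_natl addrC lerD2l.
  rewrite big_mkcond [leRHS]big_mkcond; apply: ler_sum => -[p q] _ /=.
  case: ifPn => [pq|_]; last by case: ifP => _; rewrite ?sqr_ge0.
  rewrite (HG _ _ pq) /= ifT; last first.
    apply/andP; split; apply: contraNneq Huv => -[<- <-] //.
    by rewrite adjacent_sym.
  rewrite -[leLHS]real_normK ?num_real // ler_sqr ?nnegrE ?addr_ge0 ?normr_ge0 //.
  exact: ler_normB.
have eqG : plus + \sum_(e : T * T | adjacent G e.1 e.2) (y e.1 - y e.2) ^+ 2 =
    4 * Delta%:R * \sum_p x p ^+ 2.
  rewrite -big_split /=.
  rewrite (eq_bigr (fun e => (y e.1 ^+ 2 + y e.2 ^+ 2) *+ 2)); last by move=> e _; ring.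
  rewrite sumrMnl big_split /= (sum_adjacent_swap G (fun p _ => y p ^+ 2)).
  rewrite (sum_incident G (fun p => y p ^+ 2)) -mulr2n -mulrnA -[LHS]mulr_natl -[RHS]mulrA.
  congr (_ * _); rewrite mulr_sumr; apply: eq_bigr => p _.
  rewrite /y real_normK ?num_real //.
  have [/reg->|/x0->] := boolP (p \in vertices G); first by rewrite mulr_natl.
  by rewrite expr0n mulr0 mul0rn.
rewrite /energy -/y -[`|x u|]/(y u) -[`|x v|]/(y v); lra.
Qed.

(** The sum over the neighbours of u is controlled as a whole by the energy,
    while [potential_drop] is applied to each of the vertices farther away;
    hence the term (n + 1)/2 and the factor n - Delta - 1. *)
Lemma sum_sqr_bound (R : realFieldType) (T : finType) (G : graph T)
    (k Delta n : nat) (y : T -> R) (u v : T) :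
  (0 < k)%N -> k_connected k G -> regular G Delta -> #|vertices G| = n ->
  (5 <= n + Delta)%N ->
  (forall p, 0 <= y p) -> (forall p, p \notin vertices G -> y p = 0) ->
  u \in vertices G -> y u <= y v ->
  \sum_p y p ^+ 2 <=
  ((n%:R + 1) / 2 +
   (n%:R - Delta%:R - 1) * ((n%:R - Delta%:R + 2 * k%:R - 2) / k%:R ^+ 2)) *
  ((y u + y v) ^+ 2 + energy G y).
Proof.
move=> k0 kG reg cV nD y_ge0 y0 uV leuv.
set D := (_ / k%:R ^+ 2); set s := y u + y v; set S := energy G y.
have S0 : 0 <= S := energy_ge0 G y.
have as2 : y u ^+ 2 <= s ^+ 2 / 4.
  have : 0 <= (y v - y u) * (y v + 3 * y u).
    by rewrite mulr_ge0 ?subr_ge0 ?addr_ge0 ?mulr_ge0.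
  by rewrite /s; lra.
have dU := degree_lt_order uV; rewrite reg // cV in dU.
have kR : 0 < k%:R ^+ 2 :> R by rewrite exprn_gt0 // ltr0n.
have n1 : 0 <= n%:R - Delta%:R - 1 :> R.
  by rewrite subr_ge0 lerBrDr nat1r ler_nat.
have D0 : 0 < D.
  apply: divr_gt0 => //.
  have : 1 <= k%:R :> R by rewrite ler1n.
  by lra.
have uN : u \notin neighbours G u.
  by rewrite inE; apply/negP => /adjacentP; rewrite eqxx !andbF.
have cN : #|neighbours G u| = Delta by rewrite -(reg u uV).
set Rest := vertices G :\: (u |: neighbours G u).
have split_sum : \sum_p y p ^+ 2 = y u ^+ 2 +
    \sum_(p in neighbours G u) y p ^+ 2 + \sum_(p in Rest) y p ^+ 2.
  have sub : u |: neighbours G u \subset vertices G.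
    by rewrite subUset sub1set uV neighbours_sub.
  rewrite (bigID [in vertices G]) /= [X in _ + X]big1 ?addr0 => [|p /y0->];
    last by rewrite expr0n.
  by rewrite (big_setID (u |: neighbours G u)) /= (setIidPr sub) big_setU1.
have nbr : \sum_(p in neighbours G u) y p ^+ 2 <= Delta%:R * (s ^+ 2 / 2) + 2 * S.
  apply: (@le_trans _ _ (\sum_(p in neighbours G u)
      (2 * y u ^+ 2 + 2 * (y p - y u) ^+ 2))).
    by apply: ler_sum => p _; have := sqr_ge0 (y p - 2 * y u); lra.
  rewrite big_split /= sumr_const cN -mulr_sumr -[X in X + _]mulr_natl.
  apply: lerD; first by rewrite ler_wpM2l ?ler0n //; lra.
  by rewrite ler_pM2l // sum_neighbours_le_energy.
have far p : p \in Rest -> y p ^+ 2 <= (1 / 4 + D) * (s ^+ 2 + S).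
  rewrite !inE negb_or => /andP[/andP[pu pN] pV].
  have [lep|/ltW lep] := leP (y p) (y u).
    have : y p ^+ 2 <= y u ^+ 2 by rewrite ler_sqr ?nnegrE.
    have : 0 <= D * s ^+ 2 by rewrite mulr_ge0 ?sqr_ge0 ?ltW.
    have : 0 <= D * S by rewrite mulr_ge0 // ltW.
    lra.
  have := potential_drop kG uV pV pu pN lep; rewrite reg // cV -/S => drop.
  have dDS : (y p - y u) ^+ 2 <= D * S.
    by rewrite /D mulrAC ler_pdivlMr // mulrC.
  set d := y p - y u in dDS; have -> : y p = y u + d by rewrite /d; ring.
  set a := y u in as2 *.
  (* With D E(y) >= d^2 this is the inequality 2 sqrt(AB) <= A + B, freed of
     roots by multiplying it by D. *)
  have amgm : 2 * a * d <= S / 4 + 4 * D * a ^+ 2.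
    rewrite -(ler_pM2l D0).
    have : 0 <= (d / 2 - 2 * D * a) ^+ 2 by exact: sqr_ge0.
    lra.
  have : D * (4 * a ^+ 2) <= D * s ^+ 2 by rewrite ler_pM2l //; lra.
  lra.
have rest : \sum_(p in Rest) y p ^+ 2 <=
    (n%:R - Delta%:R - 1) * ((1 / 4 + D) * (s ^+ 2 + S)).
  apply: le_trans (ler_sum _ far) _.
  rewrite sumr_const -[leLHS]mulr_natl.
  suff -> : #|Rest|%:R = n%:R - Delta%:R - 1 :> R by [].
  rewrite /Rest cardsDS ?subUset ?sub1set ?uV ?neighbours_sub // cardsU1 uN cN cV.
  by rewrite add1n natrB // -natr1; ring.
rewrite split_sum.
have s2 := sqr_ge0 s.
have nD5 : 0 <= n%:R + Delta%:R - 5 :> R by rewrite subr_ge0 -natrD ler_nat.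
have : 0 <= (n%:R - Delta%:R + 2) / 4 * s ^+ 2 by rewrite mulr_ge0 //; lra.
have : 0 <= (n%:R + Delta%:R - 5) / 4 * S by rewrite mulr_ge0 //; lra.
lra.
Qed.

Theorem corollary1p4 (R : realType) (T : finType) (G H : graph T)
    (k Delta n : nat) :
  (2 <= k)%N ->
  k_connected k G ->
  regular G Delta ->
  #|vertices G| = n ->
  proper_subgraph H G ->
  2 * Delta%:R - laplacian_radius R H >
    (2 * (k%:R - 1) ^+ 2) /
    (2 * (n%:R - Delta%:R) * (n%:R - Delta%:R + 2 * k%:R - 4)
     + (n%:R + 1) * (k%:R - 1) ^+ 2).
Proof.
move=> k2 kG reg cV pHG; have [H0 sV sE _] := pHG.
have [w wH] := set0Pn _ H0; have wG := subsetP sV w wH.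
have kD : (k <= Delta)%N.
  by rewrite -(reg w wG); apply: leq_trans kG (connectivity_le_degree wG).
have Dn : (Delta < n)%N by rewrite -cV -(reg w wG) degree_lt_order.
have D0 : (0 < Delta)%N by lia.
have [u [v /andP[Guv Huv]]] := exists_missing_edge D0 reg pHG.
set mu := laplacian_radius R H.
have [x [x0 x_gt0 xE]] := laplacian_eigenfunction (laplacian_radiusP R H0).1.
have xG p : p \notin vertices G -> x p = 0.
  by move=> pG; apply: x0; apply: contra pG; apply: (subsetP sV).
wlog leuv : u v Guv Huv / `|x u| <= `|x v|.
  move=> th; have [|/ltW] := leP `|x u| `|x v|; first exact: th.
  by apply: th; rewrite adjacent_sym.
have /and3P[uV _ _] := adjacentP Guv.
have gap := regular_gap reg sE xG Guv Huv.
have bound : \sum_p x p ^+ 2 <= ((n%:R + 1) / 2 + (n%:R - Delta%:R - 1) *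
    ((n%:R - Delta%:R + 2 * k%:R - 2) / k%:R ^+ 2)) *
    ((`|x u| + `|x v|) ^+ 2 + energy G (fun p => `|x p|)).
  under eq_bigr => p _ do rewrite -[_ ^+ 2]real_normK ?num_real //.
  apply: (sum_sqr_bound (ltnW k2) kG reg cV _ _ _ uV leuv) => [|p|p /xG->] //.
    by lia.
  by rewrite normr0.
set Y := \sum_p x p ^+ 2 in x_gt0 xE gap bound.
have {gap} : (`|x u| + `|x v|) ^+ 2 + energy G (fun p => `|x p|) <=
    (2 * Delta%:R - mu) * Y by rewrite mulrBl lerBrDl addrA -xE.
have {bound} := bound.
set F := (_ ^+ 2 + _); set g := 2 * Delta%:R - mu => bound gap.
have F_ge0 : 0 <= F by rewrite addr_ge0 ?sqr_ge0 ?energy_ge0.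
have m1 : 1 <= n%:R - Delta%:R :> R.
  by rewrite lerBrDr nat1r ler_nat.
have kR : 2 <= k%:R :> R by rewrite ler_nat.
set m := n%:R - Delta%:R in bound m1 *.
set K := k%:R in bound kR *.
have n0 : 0 <= n%:R :> R by [].
have K1 : 0 < (K - 1) ^+ 2 by rewrite exprn_gt0 //; lra.
set C := (_ + _ * _) in bound.
set den := (X in _ / X).
have den0 : 0 < den.
  have : 0 <= 2 * m * (m + 2 * K - 4) by rewrite !mulr_ge0 //; lra.
  have : 0 < (n%:R + 1) * (K - 1) ^+ 2 by rewrite mulr_gt0 //; lra.
  by rewrite /den; lra.
(* C is what [sum_sqr_bound] gives, and the reciprocal of the claimed bound is
   den / (2 (K - 1)^2); the difference is at least
   (m + 2K - 4) / (K - 1)^2 > 0. *)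
have coef : C * (2 * (K - 1) ^+ 2) < den.
  have le : (m + 2 * K - 2) / K ^+ 2 * (K - 1) ^+ 2 <= m + 2 * K - 4.
    rewrite mulrAC ler_pdivrMr ?exprn_gt0 //; last by lra.
    rewrite -subr_ge0.
    have -> : (m + 2 * K - 4) * K ^+ 2 - (m + 2 * K - 2) * (K - 1) ^+ 2 =
      (m - 1) * (2 * K - 1) + (2 * K * (K - 2) + 1) by ring.
    by rewrite !addr_ge0 ?mulr_ge0 //; lra.
  have := @ler_wpM2l _ (m - 1) _ _ _ le; rewrite subr_ge0 => /(_ m1).
  rewrite /den /C; lra.
have F_gt0 : 0 < F.
  rewrite lt_neqAle eq_sym F_ge0 andbT; apply: contraTneq bound => ->.
  by rewrite mulr0 -ltNge.
have P0 : 0 < 2 * (K - 1) ^+ 2 by lra.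
have g_gt0 : 0 < g by rewrite -(pmulr_lgt0 _ x_gt0) (lt_le_trans F_gt0).
rewrite ltr_pdivrMr // -(ltr_pM2r F_gt0).
apply: (@le_lt_trans _ _ (g * Y * (2 * (K - 1) ^+ 2))).
  by rewrite mulrC (ler_pM2r P0).
apply: (@le_lt_trans _ _ (g * (C * F) * (2 * (K - 1) ^+ 2))).
  by rewrite (ler_pM2r P0) (ler_pM2l g_gt0).
have -> : g * (C * F) * (2 * (K - 1) ^+ 2) = g * F * (C * (2 * (K - 1) ^+ 2)).
  by ring.
by rewrite [ltRHS]mulrAC ltr_pM2l // mulr_gt0.
Qed.
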